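(* Let $\Theta$ be a finite set, $(\pi,A)$ a decision problem, $(N,\nu)$ a nest structure for $\pi$, and $\zeta>0$. Let costs be posterior-separable with entropy function $$H_\pi(p)=\inf\Big\{\zeta D_{\mathrm{KL}}(\bar\mu\Vert\bar\nu):\ \bar\mu\in\Delta(N),\ \sum_{i\in N}\bar\mu(i)\nu_i=p\Big\},\qquad p\in\Delta(\Theta).$$ Suppose $\{\nu_i:i\in N\}$ is affinely independent. For $a\in A$, $i\in N$ let $\bar a(i)=\sum_{\theta\in\Theta}\nu_i(\theta)a(\theta)$. Then a stochastic choice rule $P=(P_\theta)_{\theta\in\Theta}\in\Delta(A)^\Theta$ is optimal if and only if there is a solution $\alpha$ of $$\max_{\alpha\in\Delta(A)}\ \zeta\sum_{i\in N}\bar\nu(i)\log\Big(\sum_{a\in A}e^{\bar a(i)/\zeta}\alpha(a)\Big)$$ such that, for all $\theta\in\Theta$ and $a\in A$, $$P_\theta(a)=\sum_{i\in N}\nu_\theta(i)\,Q_i(a),\qquad\text{where}\qquad Q_i(a)=\frac{\alpha(a)e^{\bar a(i)/\zeta}}{\sum_{b\in A}\alpha(b)e^{\bar b(i)/\zeta}}.$$ Moreover, for any such $P$ and $\alpha$, it holds that $\alpha=P_\pi$.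
   Context: A decision problem $(\pi,A)$: full-support prior $\pi\in\Delta(\Theta)$ and finite nonempty $A\subset\mathbb{R}^\Theta$. A nest structure $(N,\nu)$ for $\pi$ consists of a finite set $N$ and a joint distribution $\nu\in\Delta(N\times\Theta)$ whose marginal $\bar\nu$ on $N$ has full support and whose marginal on $\Theta$ is $\pi$; $\nu_i\in\Delta(\Theta)$ is the conditional distribution on states given nest $i$, and $\nu_\theta\in\Delta(N)$, $\nu_\theta(i)=\nu(i,\theta)/\pi(\theta)$, is the conditional distribution on nests given state $\theta$. Affine independence refers to the indexed family $(\nu_i)_{i\in N}$ (so the $\nu_i$ are in particular distinct). The infimum over the empty set is $+\infty$. $D_{\mathrm{KL}}(\beta\Vert\alpha)=\sum_x\beta(x)\log(\beta(x)/\alpha(x))$. Posterior-separable cost: $C(P,\pi)=\sum_{a\in\operatorname{supp}P_\pi}P_\pi(a)H_\pi(p_a)$, with $P_\pi=\sum_\theta\pi(\theta)P_\theta$ and $p_a(\theta)=\pi(\theta)P_\theta(a)/P_\pi(a)$. $P$ is optimal if it maximizes $\sum_\theta\pi(\theta)\sum_aP_\theta(a)a(\theta)-C(P,\pi)$ over $\Delta(A)^\Theta$. *)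

(* Defs.v *)
From mathcomp Require Import all_boot all_order all_algebra finmap.
From mathcomp Require Import all_classical all_reals ereal sequences exp.
Set Implicit Arguments.
Unset Strict Implicit.
Unset Printing Implicit Defensive.
Import Order.TTheory GRing.Theory Num.Theory.
Local Open Scope classical_set_scope.
Local Open Scope ring_scope.

Definition simplex (R : realType) (X : finType) : set {ffun X -> R} :=
  [set p | (forall x, 0 <= p x) /\ \sum_x p x = 1].
Arguments simplex : clear implicits.

Definition maximizes (T : Type) (d : Order.disp_t) (V : porderType d)
    (f : T -> V) (D : set T) (x : T) : Prop :=
  D x /\ forall y, D y -> (f y <= f x)%O.

Definition affinely_independent (R : realType) (I X : finType)
    (v : I -> {ffun X -> R}) : Prop :=
  forall c : I -> R,
    \sum_i c i = 0 -> (forall x, \sum_i c i * v i x = 0) -> forall i, c i = 0.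

(* Since [ln 0 = 0] and [_ / 0 = 0], terms with [beta x = 0] vanish, while
   [beta x > 0 = alpha x] needs the explicit value [+oo]. *)
Definition KL (R : realType) (X : finType) (beta alpha : {ffun X -> R}) : \bar R :=
  if [forall x, (alpha x == 0) ==> (beta x == 0)]
  then (\sum_x beta x * ln (beta x / alpha x))%:E
  else +oo%E.

Section DecisionProblem.
Variables (R : realType) (Theta : finType).

Definition decision_problem (pi : {ffun Theta -> R})
    (A : {fset {ffun Theta -> R}}) : Prop :=
  [/\ simplex R Theta pi, (forall t, 0 < pi t) & A != fset0].

Definition choice_rules (X : finType) : set {ffun Theta -> {ffun X -> R}} :=
  [set P | forall t, simplex R X (P t)].

Definition choice_marginal (X : finType) (pi : {ffun Theta -> R})
    (P : {ffun Theta -> {ffun X -> R}}) : {ffun X -> R} :=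
  [ffun a => \sum_t pi t * P t a].

Definition posterior (X : finType) (pi : {ffun Theta -> R})
    (P : {ffun Theta -> {ffun X -> R}}) (a : X) : {ffun Theta -> R} :=
  [ffun t => pi t * P t a / choice_marginal pi P a].

Definition ps_cost (X : finType) (pi : {ffun Theta -> R})
    (H : {ffun Theta -> R} -> \bar R) (P : {ffun Theta -> {ffun X -> R}}) : \bar R :=
  (\sum_(a | choice_marginal pi P a != 0%R)
     (choice_marginal pi P a)%:E * H (posterior pi P a))%E.

Definition net_payoff (pi : {ffun Theta -> R}) (A : {fset {ffun Theta -> R}})
    (H : {ffun Theta -> R} -> \bar R) (P : {ffun Theta -> {ffun A -> R}}) : \bar R :=
  ((\sum_t pi t * \sum_(a : A) P t a * val a t)%:E - ps_cost pi H P)%E.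

Definition optimal (pi : {ffun Theta -> R}) (A : {fset {ffun Theta -> R}})
    (H : {ffun Theta -> R} -> \bar R) (P : {ffun Theta -> {ffun A -> R}}) : Prop :=
  maximizes (net_payoff pi H) (@choice_rules A) P.

End DecisionProblem.
Arguments choice_rules : clear implicits.

Section Nests.
Variables (R : realType) (Theta N : finType) (nu : {ffun N * Theta -> R}).

Definition nest_marginal : {ffun N -> R} := [ffun i => \sum_t nu (i, t)].

Definition nest_structure (pi : {ffun Theta -> R}) : Prop :=
  [/\ simplex R (N * Theta)%type nu,
      (forall i, 0 < nest_marginal i) &
      (forall t, \sum_i nu (i, t) = pi t)].

Definition state_given_nest (i : N) : {ffun Theta -> R} :=
  [ffun t => nu (i, t) / nest_marginal i].

Definition nest_given_state (pi : {ffun Theta -> R}) (t : Theta) : {ffun N -> R} :=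
  [ffun i => nu (i, t) / pi t].

(* The infimum is taken in the extended reals, so it is [+oo] when [p] is not a
   mixture of the conditionals [state_given_nest i]. *)
Definition nest_entropy (zeta : R) (p : {ffun Theta -> R}) : \bar R :=
  ereal_inf [set (zeta%:E * KL mu nest_marginal)%E | mu in
    [set mu | simplex R N mu /\
              forall t, \sum_i mu i * state_given_nest i t = p t]].

Definition nest_payoff (a : {ffun Theta -> R}) (i : N) : R :=
  \sum_t state_given_nest i t * a t.

Definition nested_logit_objective (A : {fset {ffun Theta -> R}}) (zeta : R)
    (alpha : {ffun A -> R}) : R :=
  zeta * \sum_i nest_marginal i *
    ln (\sum_(a : A) expR (nest_payoff (val a) i / zeta) * alpha a).

Definition nest_choice (A : {fset {ffun Theta -> R}}) (zeta : R)
    (alpha : {ffun A -> R}) (i : N) (a : A) : R :=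
  alpha a * expR (nest_payoff (val a) i / zeta) /
    \sum_(b : A) alpha b * expR (nest_payoff (val b) i / zeta).

Definition nested_logit (pi : {ffun Theta -> R}) (A : {fset {ffun Theta -> R}})
    (zeta : R) (alpha : {ffun A -> R}) (P : {ffun Theta -> {ffun A -> R}}) : Prop :=
  forall (t : Theta) (a : A),
    P t a = \sum_i nest_given_state pi t i * nest_choice zeta alpha i a.

End Nests.

(* Main.v *)
(* By affine independence, a choice rule with finite cost is the same thing as a
   choice rule [Q] on nests, followed by a draw of the nest given the state; its
   net payoff is then the value [V Q] of [Q] in the rational inattention problem
   with prior [nest_marginal] on nests and mutual information cost.  For that
   problem, with [F] the nested logit objective, [Qbar] the marginal of [Q] and
   [L alpha] the logit rule of [alpha],
     V Q - zeta D(Qbar || alpha) = F alpha - zeta sum_i m_i D(Q_i || L_i alpha).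
   Taking [alpha := Qbar] gives [V Q <= F Qbar], and [Q := L alpha] gives
   [F alpha <= V (L alpha)], each with its equality case by Gibbs' inequality, so
   the two maximization problems have the same value and corresponding solutions. *)
Require Import Defs.
From mathcomp Require Import all_boot all_order all_algebra finmap.
From mathcomp Require Import all_classical all_reals ereal sequences exp.
From mathcomp Require Import ring lra.
Import Order.TTheory GRing.Theory Num.Theory.
Local Open Scope classical_set_scope.
Local Open Scope ring_scope.

Set Implicit Arguments.
Unset Strict Implicit.
Unset Printing Implicit Defensive.

(** * Gibbs' inequality with its equality case *)

Section RelativeEntropy.
Variables (R : realType) (X : finType).

Definition relative_entropy (p q : X -> R) : R := \sum_x p x * ln (p x / q x).

(** For positive [x] and [y] this is [1 + u <= expR u] at [u = ln (y / x)], multiplied by [x] and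
    strict unless [u = 0]. The last hypothesis excludes [y = 0 < x], where the convention
    [x / 0 = 0] would break the bound. *)
Lemma mul_ln_ge (x y : R) : 0 <= x -> 0 <= y -> (y = 0 -> x = 0) ->
  x - y <= x * ln (x / y) ?= iff (x == y).
Proof.
move=> x0 y0 yx; have [xE|xN0] := eqVneq x 0.
  rewrite xE !mul0r sub0r; apply/leifP; case: eqVneq => [<-|]; rewrite ?oppr0//.
  by rewrite oppr_lt0 lt_def y0 eq_sym => ->.
have xp : 0 < x by rewrite lt_def xN0.
have yp : 0 < y by rewrite lt_def y0 andbT; apply: contra_neq xN0.
have -> : x * ln (x / y) = - (x * ln (y / x)).
  by rewrite -(invf_div x y) lnV ?mulrN ?opprK// posrE divr_gt0.
apply/leifP; case: eqVneq => [<-|xy]; first by rewrite divff// ln1 mulr0 oppr0 subrr.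
have nz : ln (y / x) != 0.
  rewrite ln_eq0 ?divr_gt0//; apply: contra_neq xy => /(congr1 ( *%R^~ x)).
  by rewrite divfK// mul1r.
have := expR_gt1Dx nz; rewrite lnK ?posrE ?divr_gt0// -(ltr_pM2r xp) divfK// => h.
lra.
Qed.

(** In the sum of the pointwise bounds the linear parts cancel, both masses being 1; [leif_sum]
    carries the equality case along. *)
Lemma relative_entropy_ge0 (p q : {ffun X -> R}) :
  simplex R X p -> simplex R X q -> (forall x, q x = 0 -> p x = 0) ->
  0 <= relative_entropy p q ?= iff (p == q).
Proof.
move=> [p0 p1] [q0 q1] pq.
have := leif_sum (fun x (_ : xpredT x) => mul_ln_ge (p0 x) (q0 x) (pq x)).
rewrite sumrB p1 q1 subrr; congr (_ <= _ ?= iff _).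
apply/forallP/eqP => [h|-> x]; first by apply/ffunP => x; have /eqP := h x.
by rewrite eqxx.
Qed.

End RelativeEntropy.

(** * Marginals, posteriors and mutual information of a choice rule *)

Section ChoiceRules.
Variables (R : realType) (I X : finType) (m : {ffun I -> R}).
Variable Q : {ffun I -> {ffun X -> R}}.
Hypotheses (m1 : simplex R I m) (mp : forall i, 0 < m i) (HQ : choice_rules R I X Q).

Lemma choice_marginal_simplex : simplex R X (choice_marginal m Q).
Proof.
split=> [x|].
  by rewrite ffunE sumr_ge0// => i _; rewrite mulr_ge0 ?(ltW (mp i)) ?(HQ i).1.
under eq_bigr do rewrite ffunE; rewrite exchange_big/= -m1.2.
by apply: eq_bigr => i _; rewrite -mulr_sumr (HQ i).2 mulr1.
Qed.

Lemma choice_marginal_eq0 x : choice_marginal m Q x = 0 -> forall i, Q i x = 0.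
Proof.
rewrite ffunE => h i; apply/eqP.
have /eqP : m i * Q i x = 0.
  by apply: (psumr_eq0P _ h) => // j _; exact: mulr_ge0 (ltW (mp j)) ((HQ j).1 x).
by rewrite mulf_eq0 (gt_eqF (mp i)).
Qed.

Lemma posterior_simplex x : choice_marginal m Q x != 0 -> simplex R I (posterior m Q x).
Proof.
move=> hx; split=> [i|].
  by rewrite ffunE divr_ge0 ?mulr_ge0 ?(ltW (mp i)) ?(HQ i).1 ?choice_marginal_simplex.1.
by under eq_bigr do rewrite ffunE; rewrite -mulr_suml; move: hx; rewrite ffunE => /divff.
Qed.

(** Bayes' rule, in a form that also covers actions never chosen: there both sides are 0. *)
Lemma marginal_mul_posterior x i :
  choice_marginal m Q x * posterior m Q x i = m i * Q i x.
Proof.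
rewrite [posterior _ _ _ _]ffunE; have [h|h] := eqVneq (choice_marginal m Q x) 0.
  by rewrite h choice_marginal_eq0// mul0r mulr0.
by rewrite mulrCA divff// mulr1.
Qed.

(** Symmetry of mutual information: by Bayes' rule, posterior over prior and conditional choice over
    marginal choice are the same ratio. *)
Lemma information_cost :
  \sum_x choice_marginal m Q x * relative_entropy (posterior m Q x) m =
  \sum_i m i * relative_entropy (Q i) (choice_marginal m Q).
Proof.
under eq_bigr do rewrite mulr_sumr.
under [RHS]eq_bigr do rewrite mulr_sumr.
rewrite exchange_big; apply: eq_bigr => i _; apply: eq_bigr => x _ /=.
rewrite !mulrA marginal_mul_posterior; congr (_ * ln _).
by rewrite [posterior _ _ _ _]ffunE mulrAC [m i * _]mulrC mulfK// gt_eqF.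
Qed.

End ChoiceRules.

(** * The rational inattention problem on nests *)

Section NestedLogit.
Variables (R : realType) (Theta N : finType) (pi : {ffun Theta -> R}).
Variables (A : {fset {ffun Theta -> R}}) (nu : {ffun N * Theta -> R}) (zeta : R).
Hypotheses (pi_gt0 : forall t, 0 < pi t) (hnu : nest_structure nu pi) (zeta_gt0 : 0 < zeta).

Local Notation m := (nest_marginal nu).
Local Notation D := relative_entropy.
Local Notation "Q ^bar" := (choice_marginal m Q) (at level 2, format "Q ^bar").

(** The subtracted sum is mutual information averaged over nests; [information_cost] turns it into
    the form averaged over posteriors. *)
Definition nest_value (Q : {ffun N -> {ffun A -> R}}) : R :=
  \sum_i m i * (\sum_(a : A) Q i a * nest_payoff nu (val a) i)
  - zeta * \sum_i m i * D (Q i) Q^bar.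

Definition logit_rule (alpha : {ffun A -> R}) : {ffun N -> {ffun A -> R}} :=
  [ffun i => [ffun a => nest_choice nu zeta alpha i a]].

Let m_gt0 i : 0 < m i. Proof. by have [_ + _] := hnu; apply. Qed.

Let nu_ge0 i t : 0 <= nu (i, t). Proof. by have [[]] := hnu. Qed.

Lemma nest_marginal_simplex : simplex R N m.
Proof.
have [[n0 n1] mp _] := hnu; split=> [i|]; first exact: ltW.
rewrite -n1; under eq_bigr do rewrite ffunE.
by rewrite pair_bigA; apply: eq_bigr => -[].
Qed.

Lemma logit_denominator_gt0 (alpha : {ffun A -> R}) i : simplex R A alpha ->
  0 < \sum_(a : A) alpha a * expR (nest_payoff nu (val a) i / zeta).
Proof.
move=> [a0 a1]; rewrite lt_def sumr_ge0 ?andbT; last first.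
  by move=> a _; rewrite mulr_ge0 ?expR_ge0.
apply/eqP => h; have : \sum_a alpha a = 0.
  apply: big1 => a _; apply/eqP.
  have /eqP : alpha a * expR (nest_payoff nu (val a) i / zeta) = 0.
    by apply: (psumr_eq0P _ h) => // b _; rewrite mulr_ge0 ?expR_ge0.
  by rewrite mulf_eq0 (gt_eqF (expR_gt0 _)) orbF.
by rewrite a1 => /eqP; rewrite oner_eq0.
Qed.

Lemma logit_rule_choice_rules (alpha : {ffun A -> R}) : simplex R A alpha ->
  choice_rules R N A (logit_rule alpha).
Proof.
move=> ha i; have Zp := logit_denominator_gt0 i ha; split=> [a|].
  by rewrite !ffunE divr_ge0 ?(ltW Zp)// mulr_ge0 ?expR_ge0 ?ha.1.
by under eq_bigr do rewrite !ffunE; rewrite -mulr_suml divff ?gt_eqF.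
Qed.

Lemma logit_rule_eq0 (alpha : {ffun A -> R}) i a :
  alpha a = 0 -> logit_rule alpha i a = 0.
Proof. by move=> h; rewrite !ffunE /nest_choice h !mul0r. Qed.

(* Both sides equal the payoff of [Q] minus [zeta] times the sum of
   [m i * Q i a * ln (Q i a / alpha a)]. *)
Lemma compensation_identity Q (alpha : {ffun A -> R}) :
  choice_rules R N A Q -> simplex R A alpha ->
  (forall i a, alpha a = 0 -> Q i a = 0) ->
  nest_value Q - zeta * D Q^bar alpha =
  nested_logit_objective nu zeta alpha
  - zeta * \sum_i m i * D (Q i) (logit_rule alpha i).
Proof.
move=> HQ ha dom.
have -> : D Q^bar alpha = \sum_i m i * \sum_a Q i a * ln (Q^bar a / alpha a).
  rewrite /D; under eq_bigr do rewrite {1}[Q^bar _]ffunE mulr_suml.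
  rewrite exchange_big; apply: eq_bigr => i _; rewrite mulr_sumr.
  by apply: eq_bigr => a _; rewrite mulrA.
rewrite /nest_value /nested_logit_objective !mulr_sumr -!sumrB.
apply: eq_bigr => i _; set Z := (X in ln X).
have ZE : Z = \sum_(a : A) alpha a * expR (nest_payoff nu (val a) i / zeta).
  by apply: eq_bigr => a _; rewrite mulrC.
have Zp : 0 < Z by rewrite ZE logit_denominator_gt0.
(* Since [Q i] has mass 1, [ln Z] spreads over the actions and the two sides can be compared action
   by action. *)
rewrite -[ln Z]mulr1 -(HQ i).2 /D !mulr_sumr -!sumrB.
apply: eq_bigr => a _.
have [Q0|QN0] := eqVneq (Q i a) 0; first by rewrite Q0 !(mul0r, mulr0, subr0).
have Qp : 0 < Q i a by rewrite lt_def QN0 (HQ i).1.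
have ap : 0 < alpha a.
  by rewrite lt_def ha.1 andbT; apply: contra_neq QN0; exact: dom.
have Qbp : 0 < Q^bar a.
  rewrite lt_def (choice_marginal_simplex nest_marginal_simplex m_gt0 HQ).1 andbT.
  by apply: contra_neq QN0 => h; exact: (choice_marginal_eq0 m_gt0 HQ h).
have -> : logit_rule alpha i a = nest_choice nu zeta alpha i a by rewrite !ffunE.
rewrite /nest_choice -ZE.
rewrite !ln_div ?posrE ?divr_gt0 ?mulr_gt0 ?expR_gt0//.
rewrite lnM ?posrE ?expR_gt0// expRK.
by field; rewrite gt_eqF.
Qed.

Lemma logit_objective_eq (alpha : {ffun A -> R}) : simplex R A alpha ->
  nested_logit_objective nu zeta alpha =
  nest_value (logit_rule alpha) - zeta * D (logit_rule alpha)^bar alpha.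
Proof.
move=> ha; have HQ := logit_rule_choice_rules ha.
rewrite compensation_identity// ?big1 ?mulr0 ?subr0//; last first.
  by move=> i a; exact: logit_rule_eq0.
move=> i _; have := relative_entropy_ge0 (HQ i) (HQ i) (fun _ => id).
by case=> _; rewrite eqxx => /eqP <-; rewrite mulr0.
Qed.

Lemma nest_value_le_objective Q : choice_rules R N A Q ->
  nest_value Q <= nested_logit_objective nu zeta Q^bar ?= iff
  (Q == logit_rule Q^bar).
Proof.
move=> HQ.
have hb := choice_marginal_simplex nest_marginal_simplex m_gt0 HQ.
have Qdom i a : Q^bar a = 0 -> Q i a = 0.
  by move=> h; exact: (choice_marginal_eq0 m_gt0 HQ h).
have HL := logit_rule_choice_rules hb.
(* Absolute continuity for Gibbs' inequality: exponentials and denominators are positive, so the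
   logit rule vanishes only where its marginal does. *)
have Ldom i a : logit_rule Q^bar i a = 0 -> Q i a = 0.
  have [/Qdom//|h] := eqVneq (Q^bar a) 0.
  rewrite !ffunE /nest_choice => /eqP; rewrite !mulf_eq0 invr_eq0 (negPf h).
  by rewrite (gt_eqF (expR_gt0 _)) (gt_eqF (logit_denominator_gt0 i hb)).
have Db0 : D Q^bar Q^bar = 0.
  by have [_] := relative_entropy_ge0 hb hb (fun _ => id); rewrite eqxx => /eqP.
have E := compensation_identity HQ hb Qdom.
rewrite Db0 mulr0 subr0 in E.
(* The weights [m i] are positive, so the weighted sum vanishes only if every divergence does. *)
have Dl i : 0 <= m i * D (Q i) (logit_rule Q^bar i) ?= iff (Q i == logit_rule Q^bar i).
  have [h1 h2] := relative_entropy_ge0 (HQ i) (HL i) (@Ldom i).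
  split; first by rewrite mulr_ge0 ?(ltW (m_gt0 i)).
  by rewrite -h2 eq_sym mulf_eq0 (gt_eqF (m_gt0 i)) [RHS]eq_sym.
have [S1 S2] := leif_sum (fun i (_ : xpredT i) => Dl i).
rewrite big1_eq in S1 S2; rewrite E; split.
  by rewrite gerBl mulr_ge0 ?(ltW zeta_gt0).
rewrite -subr_eq0 addrAC subrr sub0r oppr_eq0 mulf_eq0 (gt_eqF zeta_gt0) eq_sym S2.
rewrite orFb; apply/forallP/eqP => [h|<- i]; last by rewrite eqxx.
by apply/ffunP => i; exact/eqP/h.
Qed.

Lemma objective_le_nest_value (alpha : {ffun A -> R}) : simplex R A alpha ->
  nested_logit_objective nu zeta alpha <= nest_value (logit_rule alpha) ?= iff
  ((logit_rule alpha)^bar == alpha).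
Proof.
move=> ha; have HQ := logit_rule_choice_rules ha.
have hb := choice_marginal_simplex nest_marginal_simplex m_gt0 HQ.
have dom a : alpha a = 0 -> (logit_rule alpha)^bar a = 0.
  by move=> h; rewrite ffunE big1// => i _; rewrite logit_rule_eq0// mulr0.
have [h1 h2] := relative_entropy_ge0 hb ha dom.
rewrite logit_objective_eq//; split; first by rewrite gerBl mulr_ge0 ?(ltW zeta_gt0).
by rewrite -subr_eq0 addrAC subrr sub0r oppr_eq0 mulf_eq0 (gt_eqF zeta_gt0) orFb eq_sym.
Qed.

(** Every nest value is at most the objective at [alpha], which is at most the value of
    [logit_rule alpha]. Applying the first bound to this very rule gives equality in the second, and
    its equality case is the marginal condition. *)
Lemma logit_rule_maximizes (alpha : {ffun A -> R}) :
  maximizes (nested_logit_objective nu zeta) (simplex R A) alpha ->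
  maximizes nest_value (choice_rules R N A) (logit_rule alpha) /\
  (logit_rule alpha)^bar = alpha.
Proof.
move=> [ha amax]; have HQ := logit_rule_choice_rules ha.
have upper Q : choice_rules R N A Q -> nest_value Q <= nested_logit_objective nu zeta alpha.
  move=> HQ'; apply: le_trans (nest_value_le_objective HQ').1 (amax _ _).
  exact: choice_marginal_simplex nest_marginal_simplex m_gt0 HQ'.
have [l1 l2] := objective_le_nest_value ha.
split; last by apply/eqP; rewrite -l2 eq_le l1 upper.
by split=> // Q HQ'; exact: le_trans (upper _ HQ') l1.
Qed.

(** The mirror argument: each objective value is at most the value of a logit rule, hence at most
    [nest_value Q]. At the marginal of [Q] this forces the equality case of
    [nest_value_le_objective]. *)
Lemma marginal_maximizes Q :
  maximizes nest_value (choice_rules R N A) Q ->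
  maximizes (nested_logit_objective nu zeta) (simplex R A) Q^bar /\
  Q = logit_rule Q^bar.
Proof.
move=> [HQ Qmax]; have hb := choice_marginal_simplex nest_marginal_simplex m_gt0 HQ.
have lower beta : simplex R A beta -> nested_logit_objective nu zeta beta <= nest_value Q.
  move=> hbeta; apply: le_trans (objective_le_nest_value hbeta).1 (Qmax _ _).
  exact: logit_rule_choice_rules.
have [l1 l2] := nest_value_le_objective HQ.
split; last by apply/eqP; rewrite -l2 eq_le l1 lower.
by split=> // beta hbeta; exact: le_trans (lower _ hbeta) l1.
Qed.

(** * Transfer of choice rules from nests to states *)

Definition nested_rule (Q : {ffun N -> {ffun A -> R}}) : {ffun Theta -> {ffun A -> R}} :=
  [ffun t => [ffun a => \sum_i nest_given_state nu pi t i * Q i a]].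

Lemma nested_logitE (alpha : {ffun A -> R}) P :
  nested_logit nu pi zeta alpha P <-> P = nested_rule (logit_rule alpha).
Proof.
have E t a : nested_rule (logit_rule alpha) t a =
    \sum_i nest_given_state nu pi t i * nest_choice nu zeta alpha i a.
  rewrite [nested_rule _ _]ffunE [LHS]ffunE; apply: eq_bigr => i _; congr (_ * _).
  by rewrite !ffunE.
split=> [h|-> //]; apply/ffunP => t; apply/ffunP => a; rewrite E; exact: h.
Qed.

Lemma mul_state_given_nest i t : m i * state_given_nest nu i t = nu (i, t).
Proof. by rewrite [state_given_nest _ _ _]ffunE mulrC divfK ?gt_eqF. Qed.

Lemma sum_state_given_nest i : \sum_t state_given_nest nu i t = 1.
Proof.
under eq_bigr do rewrite ffunE; rewrite -mulr_suml.
by have := m_gt0 i; rewrite ffunE => /gt_eqF/negbT/divff.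
Qed.

Lemma nested_rule_choice_rules Q : choice_rules R N A Q ->
  choice_rules R Theta A (nested_rule Q).
Proof.
move=> HQ t; split=> [a|].
  rewrite !ffunE sumr_ge0// => i _; rewrite ffunE mulr_ge0 ?(HQ i).1//.
  by rewrite divr_ge0 ?(ltW (pi_gt0 t)).
under eq_bigr do rewrite !ffunE; rewrite exchange_big/=.
under eq_bigr do rewrite -mulr_sumr (HQ _).2 mulr1 ffunE.
by have [_ _ hpi] := hnu; rewrite -mulr_suml hpi divff ?gt_eqF.
Qed.

Lemma mul_nested_rule Q t a : pi t * nested_rule Q t a = \sum_i nu (i, t) * Q i a.
Proof.
rewrite !ffunE mulr_sumr; apply: eq_bigr => i _.
by rewrite ffunE mulrA [pi t * _]mulrC divfK ?gt_eqF.
Qed.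

Lemma choice_marginal_nested_rule Q : choice_marginal pi (nested_rule Q) = Q^bar.
Proof.
apply/ffunP => a; rewrite ffunE; under eq_bigr do rewrite mul_nested_rule.
rewrite ffunE exchange_big; apply: eq_bigr => i _; rewrite -mulr_suml.
by rewrite ffunE.
Qed.

(** Action and state are independent given the nest. For a chosen action this provides the mixture
    at which the entropy is evaluated. *)
Lemma posterior_nested_rule Q a t :
  posterior pi (nested_rule Q) a t =
  \sum_i posterior m Q a i * state_given_nest nu i t.
Proof.
rewrite [LHS]ffunE mul_nested_rule choice_marginal_nested_rule mulr_suml.
apply: eq_bigr => i _; rewrite -mul_state_given_nest [posterior _ _ _ _]ffunE.
by rewrite [RHS]mulrAC; congr (_ / _); rewrite mulrAC.
Qed.

Lemma gross_payoff_nested_rule Q :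
  \sum_t pi t * \sum_(a : A) nested_rule Q t a * val a t =
  \sum_i m i * \sum_(a : A) Q i a * nest_payoff nu (val a) i.
Proof.
transitivity (\sum_t \sum_(a : A) \sum_i nu (i, t) * Q i a * val a t).
  apply: eq_bigr => t _; rewrite mulr_sumr; apply: eq_bigr => a _.
  by rewrite mulrA mul_nested_rule mulr_suml.
rewrite exchange_big/=; under eq_bigr do rewrite exchange_big.
rewrite exchange_big/=; apply: eq_bigr => i _; rewrite mulr_sumr.
apply: eq_bigr => a _; rewrite /nest_payoff !mulr_sumr; apply: eq_bigr => t _.
by rewrite -mul_state_given_nest; ring.
Qed.

(** * Consequences of affine independence: exact costs and recovery of the nest rule *)

Section AffineIndependence.
Hypothesis hind : affinely_independent (state_given_nest nu).

(** Affine independence asks that the coefficients [c i - d i] sum to zero; summing the hypothesis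
    over states gives this, each conditional having mass 1. *)
Lemma nest_mixture_inj (c d : {ffun N -> R}) :
  (forall t, \sum_i c i * state_given_nest nu i t = \sum_i d i * state_given_nest nu i t) ->
  c = d.
Proof.
have mass (e : {ffun N -> R}) : \sum_i e i = \sum_t \sum_i e i * state_given_nest nu i t.
  rewrite exchange_big; apply: eq_bigr => i _.
  by rewrite -mulr_sumr sum_state_given_nest mulr1.
move=> h; apply/ffunP => i; apply/eqP; rewrite -subr_eq0; apply/eqP.
apply: (hind (c := fun i => c i - d i)).
  by rewrite sumrB !mass -sumrB big1// => t _; rewrite h subrr.
by move=> t; under eq_bigr do rewrite mulrBl; rewrite sumrB h subrr.
Qed.

(** By injectivity the infimum ranges over a single [mu], and full support of the nest marginal puts
    [KL] in its finite branch. *)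
Lemma nest_entropy_mixture (mu : {ffun N -> R}) (p : {ffun Theta -> R}) :
  simplex R N mu -> (forall t, \sum_i mu i * state_given_nest nu i t = p t) ->
  nest_entropy nu zeta p = (zeta * D mu m)%:E.
Proof.
move=> hmu hp; rewrite /nest_entropy; set S := [set mu0 | _].
have -> : S = [set mu].
  apply/seteqP; split=> [mu' [_ h]|_ ->//]; apply: nest_mixture_inj => t.
  by rewrite h hp.
rewrite image_set1 ereal_inf1 /KL ifT ?EFinM//.
by apply/forallP => i; rewrite (gt_eqF (m_gt0 i)).
Qed.

Lemma nest_entropy_notin (p : {ffun Theta -> R}) :
  ~ (exists2 mu, simplex R N mu & forall t, \sum_i mu i * state_given_nest nu i t = p t) ->
  nest_entropy nu zeta p = +oo%E.
Proof.
move=> h; rewrite /nest_entropy; set S := [set mu0 | _].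
have -> : S = set0 by apply/seteqP; split=> // mu [h1 h2]; apply: h; exists mu.
by rewrite image_set0 ereal_inf0.
Qed.

Lemma net_payoff_nested_rule Q : choice_rules R N A Q ->
  net_payoff pi (nest_entropy nu zeta) (nested_rule Q) = (nest_value Q)%:E.
Proof.
move=> HQ; rewrite /net_payoff gross_payoff_nested_rule /nest_value EFinB.
congr (_ - _)%E; rewrite /ps_cost choice_marginal_nested_rule.
rewrite -(information_cost m_gt0 HQ).
transitivity (\sum_(a | Q^bar a != 0%R) (zeta * (Q^bar a * D (posterior m Q a) m))%R%:E)%E.
  apply: eq_bigr => a ha.
  have hmix t := esym (posterior_nested_rule Q a t).
  rewrite (nest_entropy_mixture _ hmix); last first.
    exact: posterior_simplex nest_marginal_simplex m_gt0 HQ _ ha.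
  by rewrite -EFinM mulrCA.
(* The cost sums over chosen actions only; the other terms of the full sum have zero marginal. *)
rewrite sumEFin mulr_sumr; congr (_%:E); rewrite [RHS](bigID (fun a => Q^bar a != 0))/=.
rewrite [X in _ = _ + X]big1 ?addr0// => a; rewrite negbK => /eqP ->.
by rewrite mul0r mulr0.
Qed.

(** Finite cost makes the posterior of each chosen action a mixture of the nest conditionals.
    Reading the weights as nest posteriors, Bayes' rule recovers the choice probabilities on
    nests. *)
Lemma nested_rule_surj P : choice_rules R Theta A P ->
  net_payoff pi (nest_entropy nu zeta) P != -oo%E ->
  exists2 Q, choice_rules R N A Q & P = nested_rule Q.
Proof.
move=> HP fin; set b := choice_marginal pi P.
have pi1 : simplex R Theta pi.
  have [[_ n1] _ hpi] := hnu; split=> [t|]; first exact: ltW.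
  rewrite -n1; under eq_bigr do rewrite -hpi.
  by rewrite exchange_big pair_bigA; apply: eq_bigr => -[].
have hb : simplex R A b by exact: choice_marginal_simplex.
have mixture a : exists mu : {ffun N -> R}, b a != 0 ->
    simplex R N mu /\ forall t, \sum_i mu i * state_given_nest nu i t = posterior pi P a t.
  have [ba|ba] := eqVneq (b a) 0; first by exists 0.
  apply: contrapT => no; move/negP: fin; apply; rewrite /net_payoff.
  suff -> : ps_cost pi (nest_entropy nu zeta) P = +oo%E by [].
  (* An infinite term makes the sum [+oo] provided that no term is [-oo], which is checked first. *)
  apply/esum_eqyP.
    move=> c bc; have bc0 : 0 < b c by rewrite lt_def bc hb.1.
    have [[mu h1 h2]|h] := pselect (exists2 mu, simplex R N mu &
      forall t, \sum_i mu i * state_given_nest nu i t = posterior pi P c t).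
      by rewrite (nest_entropy_mixture h1 h2) -EFinM.
    by rewrite nest_entropy_notin// gt0_muley// lte_fin.
  exists a; split=> //.
  rewrite nest_entropy_notin ?gt0_muley ?lte_fin//; first by rewrite lt_def ba hb.1.
  by move=> [mu h1 h2]; apply: no; exists mu.
have [mu hmu] := choice mixture.
have mixP t a : b a * \sum_i mu a i * state_given_nest nu i t = pi t * P t a.
  rewrite -(marginal_mul_posterior pi_gt0 HP) -/b.
  have [->|ba] := eqVneq (b a) 0; first by rewrite !mul0r.
  by rewrite (hmu a ba).2.
(* Posteriors average to the prior, so both weight vectors represent [pi] and must coincide; this is
   what gives the rule on nests total mass 1. *)
have /ffunP total : [ffun i => \sum_a b a * mu a i] = m.
  apply: nest_mixture_inj => t; transitivity (pi t); last first.
    have [_ _ <-] := hnu; by under eq_bigr do rewrite -mul_state_given_nest.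
  rewrite -[RHS]mulr1 -(HP t).2 mulr_sumr.
  under [RHS]eq_bigr do rewrite -mixP mulr_sumr.
  rewrite exchange_big; apply: eq_bigr => i _; rewrite ffunE mulr_suml.
  by apply: eq_bigr => a _; rewrite mulrA.
exists [ffun i => [ffun a => b a * mu a i / m i]].
  move=> i; split=> [a|].
    rewrite 2!ffunE; have [->|ba] := eqVneq (b a) 0; first by rewrite !mul0r.
    by rewrite divr_ge0 ?mulr_ge0 ?hb.1 ?(hmu a ba).1.1 ?(ltW (m_gt0 i)).
  under eq_bigr do rewrite 2!ffunE; rewrite -mulr_suml.
  by have := total i; rewrite ffunE => ->; rewrite divff ?gt_eqF.
apply/ffunP => t; apply/ffunP => a; apply: (mulfI (lt0r_neq0 (pi_gt0 t))).
rewrite mul_nested_rule -mixP mulr_sumr; apply: eq_bigr => i _.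
rewrite 2![in RHS]ffunE -mul_state_given_nest.
by rewrite [RHS]mulrC [RHS]mulrA divfK ?gt_eqF// mulrA.
Qed.

End AffineIndependence.

End NestedLogit.

Theorem proposition15 (R : realType) (Theta N : finType)
    (pi : {ffun Theta -> R}) (A : {fset {ffun Theta -> R}})
    (nu : {ffun N * Theta -> R}) (zeta : R)
    (hA : decision_problem pi A) (hnu : nest_structure nu pi) (hzeta : 0 < zeta)
    (hind : affinely_independent (state_given_nest nu))
    (P : {ffun Theta -> {ffun A -> R}}) (hP : choice_rules R Theta A P) :
  (optimal pi (nest_entropy nu zeta) P <->
   exists alpha : {ffun A -> R},
     maximizes (nested_logit_objective nu zeta) (simplex R A) alpha /\
     nested_logit nu pi zeta alpha P) /\
  (forall alpha : {ffun A -> R},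
     maximizes (nested_logit_objective nu zeta) (simplex R A) alpha ->
     nested_logit nu pi zeta alpha P ->
     alpha = choice_marginal pi P).
Proof.
have [_ pip An0] := hA.
have payoffE Q HQ := @net_payoff_nested_rule _ _ _ _ A _ zeta pip hnu hind Q HQ.
have lift Q HQ := @nested_rule_choice_rules _ _ _ _ A _ pip hnu Q HQ.
have surj := @nested_rule_surj _ _ _ _ A _ zeta pip hnu hind.
split; first split=> [[_ Pmax]|[alpha [amax /nested_logitE ->]]].
(* A point mass yields a logit rule with finite payoff, so an optimal [P] also has payoff above
   [-oo] and comes from a rule on nests. *)
- have [alpha0 ha0] : exists alpha0, simplex R A alpha0.
    have [a aA] := fset0Pn _ An0; exists [ffun x => (x == FSetSub aA)%:R]; split=> [x|].
      by rewrite ffunE ler0n.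
    rewrite (bigD1 (FSetSub aA))//= ffunE eqxx big1 ?addr0// => x /negPf xa.
    by rewrite ffunE xa.
  have HQ0 := logit_rule_choice_rules nu zeta ha0.
  have fin : net_payoff pi (nest_entropy nu zeta) P != -oo%E.
    by rewrite -ltNye; apply: lt_le_trans (Pmax _ (lift _ HQ0)); rewrite payoffE// ltNyr.
  have [Q HQ PE] := surj P hP fin.
  have Qmax : maximizes (@nest_value _ _ _ A nu zeta) (choice_rules R N A) Q.
    split=> // Q' HQ'; rewrite -lee_fin -!payoffE// -PE; exact: Pmax (lift _ HQ').
  have [bmax QE] := marginal_maximizes hnu hzeta Qmax.
  by exists (choice_marginal (nest_marginal nu) Q); split=> //; apply/nested_logitE; rewrite -QE.
- have [[HQ Qmax] _] := logit_rule_maximizes hnu hzeta amax.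
  split=> [|P' HP']; first exact: lift.
  (* A competitor either has payoff [-oo] or comes from a rule on nests, where [logit_rule alpha] is
     already maximal. *)
  have [->|fin] := eqVneq (net_payoff pi (nest_entropy nu zeta) P') -oo%E.
    exact: leNye.
  have [Q' HQ' ->] := surj P' HP' fin.
  by rewrite !payoffE// lee_fin; exact: Qmax.
- move=> alpha amax /nested_logitE ->.
  by rewrite choice_marginal_nested_rule// (logit_rule_maximizes hnu hzeta amax).2.
Qed.
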